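(* Let $0<p<1$, let $K\subseteq\mathbb{R}^n$ be a $p$-convex set, and let $F=(f_1,\ldots,f_m):K\to\mathbb{R}^m_+$ be an $\mathbb{R}^m_+$-$p$-convex function. Then $E_W=\bigcup_{i=1}^m \mathrm{argmin}\,f_i$.
   Context: For $0<p\le 1$, a set $K\subseteq\mathbb{R}^n$ is called $p$-convex if $\lambda x+\mu y\in K$ for every $x,y\in K$ and all $\lambda,\mu\ge 0$ with $\lambda^p+\mu^p=1$. $\mathbb{R}^m_+$ is the set of vectors in $\mathbb{R}^m$ with nonnegative coordinates ($m\ge 1$). For a $p$-convex set $K$, a mapping $F:K\to\mathbb{R}^m$ is $\mathbb{R}^m_+$-$p$-convex if $\lambda F(x)+\mu F(y)\in F(\lambda x+\mu y)+\mathbb{R}^m_+$ for all $x,y\in K$ and all $\lambda,\mu\ge 0$ with $\lambda^p+\mu^p=1$. A point $\bar x\in K$ is a weakly efficient point of $F$ on $K$ if $F(x)-F(\bar x)\in\mathbb{R}^m\setminus(-\mathrm{int}\,\mathbb{R}^m_+)$ for all $x\in K$, i.e. there is no $x\in K$ with $f_i(x)<f_i(\bar x)$ for all $i$. $E_W=E_W(K)$ denotes the set of weakly efficient points of $F$ on $K$. $\mathrm{argmin}\,f_i$ is the (possibly empty) set of global minimizers of $f_i$ on $K$. *)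

(* Defs.v *)
From HB Require Import structures.
From mathcomp Require Import all_boot all_order all_algebra.
From mathcomp Require Import all_classical all_reals all_analysis.

Set Implicit Arguments.
Unset Strict Implicit.
Unset Printing Implicit Defensive.

Import Order.TTheory GRing.Theory Num.Theory.
Import numFieldNormedType.Exports.

Local Open Scope classical_set_scope.
Local Open Scope ring_scope.

Definition nonneg_orthant (R : realType) (m : nat) : set 'rV[R]_m :=
  [set v | forall i, 0 <= v ord0 i].

(* For 0 < p the convention 0 `^ p = 0 holds, so the endpoints
   (lambda, mu) = (1, 0) and (0, 1) are included. *)
Definition p_convex_set (R : realType) (n : nat) (p : R)
    (K : set 'rV[R]_n) : Prop :=
  forall (x y : 'rV[R]_n) (lambda mu : R), K x -> K y ->
    0 <= lambda -> 0 <= mu -> lambda `^ p + mu `^ p = 1 ->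
    K (lambda *: x + mu *: y).

(* A map K -> R^m is represented by a total map of which only the values on K
   are used. *)
Definition p_convex_map (R : realType) (n m : nat) (p : R)
    (K : set 'rV[R]_n) (F : 'rV[R]_n -> 'rV[R]_m) : Prop :=
  forall (x y : 'rV[R]_n) (lambda mu : R), K x -> K y ->
    0 <= lambda -> 0 <= mu -> lambda `^ p + mu `^ p = 1 ->
    [set F (lambda *: x + mu *: y) + v | v in @nonneg_orthant R m]
      (lambda *: F x + mu *: F y).

Definition weakly_efficient (R : realType) (n m : nat)
    (K : set 'rV[R]_n) (F : 'rV[R]_n -> 'rV[R]_m) : set 'rV[R]_n :=
  [set xbar | K xbar /\ forall x, K x ->
     (~` [set - v | v in interior (@nonneg_orthant R m)]) (F x - F xbar)].

Definition argmin (R : realType) (n : nat) (K : set 'rV[R]_n)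
    (f : 'rV[R]_n -> R) : set 'rV[R]_n :=
  [set xbar | K xbar /\ forall x, K x -> f xbar <= f x].

(* Main.v *)
(* Taking x = y and lambda = mu = 2^(-1/p) in the definitions of p-convexity
   gives f_i(c x) <= c f_i(x) with c = 2^(1 - 1/p) < 1. Hence a point where every
   f_i is positive is strictly improved by c x, and at a weakly efficient point
   some f_i vanishes, which is its least possible value. *)
Require Import Defs.
From HB Require Import structures.
From mathcomp Require Import all_boot all_order all_algebra.
From mathcomp Require Import lra.
From mathcomp Require Import all_classical all_reals all_analysis.

Set Implicit Arguments.
Unset Strict Implicit.
Unset Printing Implicit Defensive.

Import Order.TTheory GRing.Theory Num.Theory.
Import numFieldNormedType.Exports.

Local Open Scope classical_set_scope.
Local Open Scope ring_scope.

Lemma interior_nonneg_orthantE (R : realType) (m : nat) :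
  interior (@nonneg_orthant R m) = [set v | forall i, 0 < v ord0 i].
Proof.
apply/seteqP; split => v /=.
- move=> /nbhs_ballP[e /= e0 ve] i.
  have e20 : 0 < e / 2 by rewrite divr_gt0.
  (* Lowering every coordinate by [e / 2] stays in the ball, hence in the orthant, so [v ord0 i] is
     at least [e / 2]. *)
  have /ve/(_ i) : ball v e (v - const_mx (e / 2)).
    split => // a j; rewrite !mxE /ball/= opprB addrC subrK gtr0_norm//.
    by rewrite ltr_pdivrMr// ltr_pMr// ltr1n.
  by rewrite !mxE subr_ge0; exact: lt_le_trans.
- move=> v0.
  (* Finitely many coordinates: one neighbourhood for each suffices. *)
  apply: (@filter_forall _ _ (fun i w => 0 <= w ord0 i) (nbhs v)) => i.
  have Pv : \forall w \near v, 0 < (w : 'rV[R]_m) ord0 i.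
    exact: (@coord_continuous R 1 m ord0 i v [set y | 0 < y] (lt_nbhsr (v0 i))).
  by apply: filterS Pv => w; exact: ltW.
Qed.

(** Multiplying the negative number [ln 2^-1] by [p^-1 > 1] decreases it. This makes the contraction
    factor less than 1. *)
Lemma powR_half_lt (R : realType) (p : R) : 0 < p -> p < 1 ->
  (2^-1 : R) `^ p^-1 < 2^-1.
Proof.
move=> p0 p1; have h0 : 0 < 2^-1 :> R by rewrite invr_gt0.
have hl : ln (2^-1 : R) < 0 by rewrite ln_lt0// h0 invf_lt1// ltr1n.
rewrite /powR gt_eqF// -[ltRHS]lnK// ltr_expR.
by rewrite gtr_nMl// invf_gt1.
Qed.

Lemma p_convex_contract (R : realType) (n m : nat) (p : R)
    (K : set 'rV[R]_n) (F : 'rV[R]_n -> 'rV[R]_m) :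
  0 < p -> p < 1 -> p_convex_set p K -> p_convex_map p K F ->
  exists2 c : R, c < 1 & forall x, K x ->
    K (c *: x) /\ forall i, F (c *: x) ord0 i <= c * F x ord0 i.
Proof.
move=> p0 p1 Kp Fp; pose l : R := 2^-1 `^ p^-1.
have l0 : 0 <= l by exact: powR_ge0.
have l1 : l `^ p + l `^ p = 1.
  by rewrite -powRrM mulVf ?gt_eqF// powRr1 ?invr_ge0//; lra.
exists (l + l).
  by have := powR_half_lt p0 p1; rewrite -/l; lra.
move=> x Kx; split; first by rewrite scalerDl; exact: Kp.
have [v v0 Fv] := Fp x x l l Kx Kx l0 l0 l1.
move=> i; rewrite scalerDl mulrDl.
move/matrixP: Fv => /(_ ord0 i); rewrite !mxE => <-.
by rewrite lerDl; exact: v0.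
Qed.

Theorem corollary6p4 (R : realType) (n m : nat) (p : R)
    (K : set 'rV[R]_n) (F : 'rV[R]_n -> 'rV[R]_m) :
  (0 < m)%N -> 0 < p -> p < 1 ->
  p_convex_set p K ->
  (forall x, K x -> nonneg_orthant (F x)) ->
  p_convex_map p K F ->
  weakly_efficient K F =
  \bigcup_(i in [set: 'I_m]) argmin K (fun x => F x ord0 i).
Proof.
move=> _ p0 p1 Kp F0 Fp; apply/seteqP; split => x.
- move=> [Kx xmin].
  have [c c1 /(_ x Kx)[Kcx Fcx]] := p_convex_contract p0 p1 Kp Fp.
  (* A coordinate that is at most 0 at [x] is minimal there, since [F] is nonnegative on [K]. *)
  have [[i Fxi]|Fx] := pselect (exists i, F x ord0 i <= 0).
    exists i => //; split => // y Ky.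
    by rewrite (le_trans Fxi)//; exact: F0.
  (* All coordinates are positive at [x], so [c < 1] makes each of them strictly smaller at
     [c *: x]. *)
  exfalso; apply: (xmin _ Kcx); exists (F x - F (c *: x)); last exact: opprB.
  rewrite interior_nonneg_orthantE => i /=; rewrite !mxE subr_gt0.
  rewrite (le_lt_trans (Fcx i))// gtr_pMl// ltNge.
  by apply/negP => Fxi; apply: Fx; exists i.
(* An improvement [v] in the interior would push coordinate [i] below its minimum. *)
- move=> [i _ [Kx xmin]]; split => // y Ky [v].
  rewrite interior_nonneg_orthantE => /(_ i) vi0 /matrixP/(_ ord0 i).
  by have := xmin y Ky; rewrite !mxE; lra.
Qed.
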